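(* Let $g_1,\dots,g_m\in\mathbb{R}[\mathbf{x}]$ be polynomials in $\mathbf{x}=(x_1,\dots,x_d)$, let $g_0=1$ and $g_{m+1}(\mathbf{x})=1-\|\mathbf{x}\|^2$, and let $\mathbf{\Omega}=\{\mathbf{x}\in\mathbb{R}^d: g_j(\mathbf{x})\ge 0,\ j=1,\dots,m+1\}$ (which is therefore compact). Assume that $g_j$ is SOS-concave for every $j\in\{1,\dots,m+1\}$. Let $f\in\mathbb{R}[\mathbf{x}]$ (not necessarily convex on $\mathbb{R}^d$) be Hessian-$Q$-module convex over $\mathbf{\Omega}$, that is, $$\nabla^2 f(\mathbf{x})=\sum_{j=0}^{m+1}\mathbf{L}_j(\mathbf{x})\,\mathbf{L}_j(\mathbf{x})^\top g_j(\mathbf{x}),\qquad\forall\,\mathbf{x}\in\mathbb{R}^d,$$ for some matrix polynomials $\mathbf{L}_j\in\mathbb{R}[\mathbf{x}]^{d\times r_j}$, $r_j\in\mathbb{N}$. Put $a_j=\max_{k,l}\deg(\mathbf{L}_j(k,l))$ for $j\in\{0,\dots,m+1\}$, where $\mathbf{L}_j(k,l)$ is the $(k,l)$ entry of $\mathbf{L}_j$, and $d_j=\lceil \deg(g_j)/2\rceil$. Let $n\in\mathbb{N}$ satisfy $$n\ \ge\ 1+\max\Big\{\max_{j\in\{1,\dots,m+1\}}(a_j+d_j),\ a_0\Big\},$$ and let $\boldsymbol{\phi}=(\phi_{\boldsymbol\alpha})_{\boldsymbol\alpha\in\mathbb{N}^d_{2n}}$ be a real sequence, with associated Riesz functional $\phi$,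 such that $$\phi(1)=1\quad\text{and}\quad \mathbf{M}_{n-d_j}(g_j\cdot\boldsymbol{\phi})\succeq \mathbf{0},\qquad j\in\{0,\dots,m+1\}.$$ Then $$\phi(f)\ \ge\ f(\phi(\mathbf{x})),\qquad\text{where } \phi(\mathbf{x}):=(\phi(x_1),\dots,\phi(x_d)).$$
   Context: Notation: $\mathbb{N}^d_{k}=\{\boldsymbol\alpha\in\mathbb{N}^d:\sum_i\alpha_i\le k\}$. SOS-convexity: a polynomial $p\in\mathbb{R}[\mathbf{x}]$ is SOS-convex if there is a matrix polynomial $\mathbf{L}\in\mathbb{R}[\mathbf{x}]^{d\times r}$ (for some $r$) with $\nabla^2p(\mathbf{x})=\mathbf{L}(\mathbf{x})\mathbf{L}(\mathbf{x})^\top$ for all $\mathbf{x}\in\mathbb{R}^d$; $p$ is SOS-concave if $-p$ is SOS-convex. Riesz functional: for a real sequence $\boldsymbol{\phi}=(\phi_{\boldsymbol\alpha})_{\boldsymbol\alpha\in\mathbb{N}^d_{2n}}$, $\phi$ is the linear functional on polynomials of degree at most $2n$ given by $\phi\big(\sum_{\boldsymbol\alpha} p_{\boldsymbol\alpha}\mathbf{x}^{\boldsymbol\alpha}\big)=\sum_{\boldsymbol\alpha} p_{\boldsymbol\alpha}\phi_{\boldsymbol\alpha}$. Localizing matrix: for a polynomial $g$ and $k\in\mathbb{N}$ with $2k+\deg g\le 2n$, $\mathbf{M}_k(g\cdot\boldsymbol{\phi})$ is the real symmetric matrix with rows and columns indexed by $\mathbb{N}^d_k$ and entry $(\boldsymbol\alpha,\boldsymbol\beta)$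 equal to $\phi(\mathbf{x}^{\boldsymbol\alpha+\boldsymbol\beta}g)$. For $g=g_0=1$ (with $d_0=0$) this is the moment matrix $\mathbf{M}_n(\boldsymbol{\phi})$. $\mathbf{A}\succeq\mathbf{0}$ means that $\mathbf{A}$ is positive semidefinite. Convention: the zero polynomial is given degree $0$, so $a_j\ge 0$ for all $j$. With this convention the bound on $n$ ensures $\deg f\le 2n$ and $n\ge d_j$ for all $j$, so all quantities are well defined. *)

(* Defs.v *)
From mathcomp Require Import all_boot all_order all_algebra.
From mathcomp Require Import reals.
From mathcomp Require Import mpoly.

Set Implicit Arguments.
Unset Strict Implicit.
Unset Printing Implicit Defensive.

Import Order.TTheory GRing.Theory Num.Theory.
Local Open Scope ring_scope.

Section Defs.
Context {R : realType}.
Implicit Types d k n r : nat.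

(* [msize p] is one more than the total degree, and 0 for p = 0; so the zero
   polynomial gets degree 0. *)
Definition deg d (p : {mpoly R[d]}) : nat := (msize p).-1.

(* The ceiling of deg p / 2. *)
Definition half_deg d (p : {mpoly R[d]}) : nat := uphalf (deg p).

(* 0 for a matrix without entries. *)
Definition mxdeg d p q (L : 'M[{mpoly R[d]}]_(p, q)) : nat :=
  \max_(k < p) \max_(l < q) deg (L k l).

Definition hessian d (p : {mpoly R[d]}) : 'M[{mpoly R[d]}]_d :=
  \matrix_(i, j) ((p^`M(i))^`M(j)).

Definition mxeval d p q (x : 'I_d -> R) (A : 'M[{mpoly R[d]}]_(p, q)) :
  'M[R]_(p, q) := map_mx (meval x) A.

Definition SOS_convex d (p : {mpoly R[d]}) : Prop :=
  exists r, exists L : 'M[{mpoly R[d]}]_(d, r),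
    forall x : 'I_d -> R,
      mxeval x (hessian p) = mxeval x L *m (mxeval x L)^T.

Definition SOS_concave d (p : {mpoly R[d]}) : Prop := SOS_convex (- p).

(* The matrices L are a parameter, not existentially quantified, because the
   relaxation order in the Jensen inequality depends on their degrees. The
   index set 'I_s stands for {0, ..., m + 1}. *)
Definition Hessian_Qmodule_convex_with d s (g : 'I_s -> {mpoly R[d]})
    (r : 'I_s -> nat) (L : forall j, 'M[{mpoly R[d]}]_(d, r j))
    (f : {mpoly R[d]}) : Prop :=
  forall x : 'I_d -> R,
    mxeval x (hessian f) =
      \sum_j (g j).@[x] *: (mxeval x (L j) *m (mxeval x (L j))^T).

(* ['X_{1..d < k.+1}] is the finite type of exponents of total degree <= k.
   The Riesz functional is meant for polynomials of degree at most 2 n; as a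
   total function it ignores the monomials of higher degree. *)
Definition riesz d n (phi : 'X_{1..d < (2 * n).+1} -> R) (p : {mpoly R[d]}) :
  R := \sum_(a : 'X_{1..d < (2 * n).+1}) p@_a * phi a.

Definition localizing_mx d n (k : nat) (g : {mpoly R[d]})
    (phi : 'X_{1..d < (2 * n).+1} -> R) :
    'M[R]_(#|{: 'X_{1..d < k.+1}}|) :=
  \matrix_(i, j)
    let a : 'X_{1..d < k.+1} := enum_val i in
    let b : 'X_{1..d < k.+1} := enum_val j in
    riesz phi ('X_[(a + b)%MM] * g).

Definition psdmx q (A : 'M[R]_q) : Prop :=
  A^T = A /\ forall v : 'cV[R]_q, 0 <= (v^T *m A *m v) 0 0.

End Defs.

(* Main.v *)
(* Put [y = phi(x)]. For a scalar form psi on polynomials, [h(t) = psi(p(y + t(x - y)))]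
   is a univariate polynomial in t with [h(0) = p(y) psi(1)], [h(1) = psi(p)] and
   [h''(t) = psi((x - y)^T (Hess p)(y + t(x - y)) (x - y))]. For [psi = phi] moreover
   [h'(0) = 0], so a constant sign of h'' on [0, 1] compares [p(y)] with [phi(p)].
   This gives [g_j(y) >= phi(g_j) >= 0] by SOS-concavity; then, with
   [psi(p) = phi(q^2 p)], [h] is concave with nonnegative end values for [p = g_j], so
   [phi(q^2 g_j(y + t(x - y))) >= 0]. For [p = f] the latter, applied to the entries q
   of [L_j(y + t(x - y))^T (x - y)], is exactly [h'' >= 0]. No integration in t is
   needed, and all degrees match because the entries of a factor M of a Hessian
   [M M^T] have degree at most [deg g / 2 - 1]. *)
From HB Require Import structures.
Require Import Defs.
From mathcomp Require Import all_boot all_order all_algebra.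
From mathcomp Require Import reals.
From mathcomp Require Import mpoly.
From mathcomp Require Import polyrcf ring zify.

Set Implicit Arguments.
Unset Strict Implicit.
Unset Printing Implicit Defensive.

Import Order.TTheory GRing.Theory Num.Theory.
Local Open Scope ring_scope.

(** * Sign of the second derivative of a univariate polynomial on [0, 1] *)

Section UnivariateConvexity.
Context {R : rcfType}.
Implicit Types p : {poly R}.

(** Two mean values give [p(1) - p(0) = p'(c) = p'(c) - p'(0) = p''(e) c]. *)
Lemma convex_poly_le p :
  (forall t, 0 <= t <= 1 -> 0 <= p^`()^`().[t]) -> p^`().[0] = 0 ->
  p.[0] <= p.[1].
Proof.
move=> p2_ge0 p1_eq0.
have [c c01 p01] := poly_mvt p (@ltr01 R).
have /andP[c_gt0 c_lt1] : 0 < c < 1 by move: c01; rewrite in_itv.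
have [e e0c] := poly_mvt p^`() c_gt0.
have /andP[e_gt0 e_ltc] : 0 < e < c by move: e0c; rewrite in_itv.
have /p2_ge0 p2e : 0 <= e <= 1 by rewrite !ltW // (lt_trans e_ltc).
rewrite p1_eq0 !subr0 => p1c.
by rewrite -subr_ge0 p01 p1c subr0 mulr1 mulr_ge0 // ltW.
Qed.

Lemma concave_poly_ge0 p :
  (forall t, 0 <= t <= 1 -> p^`()^`().[t] <= 0) -> 0 <= p.[0] -> 0 <= p.[1] ->
  forall t, 0 <= t <= 1 -> 0 <= p.[t].
Proof.
move=> p2_le0 p0 p1 t /andP[].
rewrite le_eqVlt => /predU1P[<- //|t_gt0].
rewrite le_eqVlt => /predU1P[-> //|t_lt1].
have [a a0t pa] := poly_mvt p t_gt0.
have /andP[a_gt0 a_ltt] : 0 < a < t by move: a0t; rewrite in_itv.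
have [b bt1 pb] := poly_mvt p t_lt1.
have /andP[b_gtt b_lt1] : t < b < 1 by move: bt1; rewrite in_itv.
have lt_ab := lt_trans a_ltt b_gtt.
have [c cab pc] := poly_mvt p^`() lt_ab.
have /andP[c_gta c_ltb] : a < c < b by move: cab; rewrite in_itv.
have /p2_le0 p2c : 0 <= c <= 1.
  by rewrite (ltW (lt_trans a_gt0 c_gta)) (ltW (lt_trans c_ltb b_lt1)).
have slope : p^`().[b] <= p^`().[a].
  by rewrite -subr_le0 pc mulr_le0_ge0 // subr_ge0 ltW.
(* The chord plus a correction by the mean slopes [p'(a)] on [0, t] and [p'(b)] on [t, 1], which
   decrease by concavity. *)
have -> : p.[t] = (1 - t) * p.[0] + t * p.[1]
    + t * (1 - t) * (p^`().[a] - p^`().[b]).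
  have -> : p.[1] = p.[t] + p^`().[b] * (1 - t) by rewrite -pb addrC subrK.
  have -> : p.[t] = p.[0] + p^`().[a] * (t - 0) by rewrite -pa addrC subrK.
  ring.
by rewrite !addr_ge0 ?mulr_ge0 ?subr_ge0 // ltW.
Qed.

Lemma poly_eq0_horner p : (forall t, p.[t] = 0) -> p = 0.
Proof.
move=> p_eq0; apply/eqP; apply: contraT => p_neq0.
pose rs : seq R := [seq i%:R | i <- iota 0 (size p)].
have rs_root : all (root p) rs by apply/allP => x _; rewrite rootE p_eq0.
have rs_uniq : uniq rs.
  rewrite map_inj_uniq ?iota_uniq // => i j /eqP.
  by rewrite eqr_nat => /eqP.
by have := max_poly_roots p_neq0 rs_root rs_uniq; rewrite size_map size_iota ltnn.
Qed.

End UnivariateConvexity.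

(** * Restriction of polynomials to lines *)

Section MpolyMorphisms.

Lemma mpoly_ring_ind d (R : nzRingType) (P : {mpoly R[d]} -> Prop) :
  (forall c, P c%:MP) -> (forall i, P 'X_i) ->
  (forall p q, P p -> P q -> P (p + q)) ->
  (forall p q, P p -> P q -> P (p * q)) ->
  forall p, P p.
Proof.
move=> PC PX PD PM; apply: mpolyind => [|c m p _ _ Pp]; first exact: (PC 0).
apply: (PD) => //; rewrite -mul_mpolyC; apply: (PM) => //.
rewrite mpolyXE_id; apply: (big_ind P) => // [|i _]; first exact: (PC 1).
elim: (m i) => [|k Pk]; first by rewrite expr0; apply: (PC 1).
by rewrite exprS; apply: PM.
Qed.

Section Line.
Context {d : nat} {R : nzRingType} {S : comNzRingType}.
Variables (iota : {rmorphism R -> S}) (a b : 'I_d -> S).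

(** The coefficient ring [S] is kept general: real lines serve the zero test below, and lines over
    [{mpoly R[d]}] serve the segment from [y] to the indeterminate point x. *)
Definition mpoly_line : {mpoly R[d]} -> {poly S} :=
  mmap (polyC \o iota) (fun i => (a i)%:P + (b i)%:P * 'X).

HB.instance Definition _ := GRing.RMorphism.on mpoly_line.

Lemma mpoly_lineC c : mpoly_line c%:MP = (iota c)%:P.
Proof. exact: mmapC. Qed.

Lemma mpoly_lineX i : mpoly_line 'X_i = (a i)%:P + (b i)%:P * 'X.
Proof. by rewrite /mpoly_line mmapX mmap1U. Qed.

Lemma horner_mpoly_line p t :
  (mpoly_line p).[t] = mmap iota (fun i => a i + b i * t) p.
Proof.
rewrite /mpoly_line /mmap horner_sum; apply: eq_bigr => m _.
rewrite hornerM hornerC; congr (_ * _).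
by rewrite /mmap1 horner_prod; apply: eq_bigr => i _; rewrite !hornerE.
Qed.

Lemma deriv_mpoly_line p :
  (mpoly_line p)^`() = \sum_i mpoly_line p^`M(i) * (b i)%:P.
Proof.
elim/mpoly_ring_ind: p => [c|i|p q Ep Eq|p q Ep Eq].
- rewrite mpoly_lineC derivC big1 // => i _.
  by rewrite mderivC raddf0 mul0r.
- have UU : (U_(i) - U_(i))%MM = 0%MM :> 'X_{1..d}.
    by apply/mnmP => j; rewrite mnmBE subnn mnm0E.
  rewrite (bigD1 i) //= mderivX mnm1E eqxx scale1r UU mpolyX0 rmorph1.
  rewrite mul1r big1 ?addr0 => [|j /negPf ij].
    by rewrite mpoly_lineX derivD derivM !derivC derivX mul0r !add0r mulr1.
  by rewrite mderivX mnm1E eq_sym ij scale0r raddf0 mul0r.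
- rewrite raddfD derivD Ep Eq -big_split /=; apply: eq_bigr => i _.
  by rewrite mderivD raddfD mulrDl.
- rewrite rmorphM derivM Ep Eq mulr_suml mulr_sumr -big_split /=.
  apply: eq_bigr => i _; rewrite mderivM raddfD /= !rmorphM /=; ring.
Qed.

End Line.

Lemma mnm_neq0_exists d (m : 'X_{1..d}) : m != 0%MM -> exists i, m i != 0%N.
Proof.
move=> m_neq0; apply/existsP; apply: contraR m_neq0 => /existsPn m0.
by apply/eqP/mnmP => i; rewrite mnm0E; apply/eqP; move/negPn: (m0 i).
Qed.

(** Induction on the degree of the monomial: the constant coefficient is the value at 0, and any
    other one is, up to a nonzero integer factor, a lower coefficient of a partial derivative, which
    vanishes everywhere too. *)
Lemma mpoly_eq0_meval d (R : rcfType) (p : {mpoly R[d]}) :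
  (forall x, p.@[x] = 0) -> p = 0.
Proof.
move=> p_eq0; apply/mpolyP => m; rewrite mcoeff0.
have [k] := ubnP (mdeg m).
elim: k m p p_eq0 => // k IH m p p_eq0; rewrite ltnS => le_mk.
have [->|m_neq0] := eqVneq m 0%MM.
  have <- := p_eq0 (fun=> 0); rewrite [in RHS](mpolyE p) raddf_sum /=.
  rewrite [in LHS](mpolyE p) raddf_sum /=; apply: eq_bigr => e _.
  rewrite mevalZ mevalX mcoeffZ mcoeffX; congr (_ * _).
  have [->|e_neq0] := eqVneq e 0%MM.
    by rewrite big1 // => i _; rewrite mnm0E expr0.
  have [i ei] := mnm_neq0_exists e_neq0.
  by rewrite (bigD1 i) //= expr0n (negPf ei) mul0r.
have [i mi] := mnm_neq0_exists m_neq0.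
have mE : m = (m - U_(i) + U_(i))%MM.
  by rewrite submK // lep1mP.
have pi_eq0 x : p^`M(i).@[x] = 0.
  (* The line through x in the i-th coordinate direction; the derivative of [F p] at 0 is the
     partial derivative at x. *)
  pose F := mpoly_line idfun x (fun j => (j == i)%:R).
  have Fp_eq0 : F p = 0.
    by apply: poly_eq0_horner => t; rewrite horner_mpoly_line; apply: p_eq0.
  have := deriv_mpoly_line idfun x (fun j => (j == i)%:R) p.
  rewrite -/F Fp_eq0 derivC (bigD1 i) //= eqxx mulr1 big1 ?addr0 => [Fi|]; last first.
    by move=> j /negPf ->; rewrite mulr0.
  rewrite -(horner0 0) Fi horner_mpoly_line.
  by apply: meval_eq => j; rewrite mulr0 addr0.
have := IH (m - U_(i))%MM _ pi_eq0.
rewrite mcoeff_deriv -mE => H.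
have /H/eqP : (mdeg (m - U_(i)) < k)%N.
  by move: le_mk; rewrite [in X in (X <= _)%N]mE mdegD mdeg1 addn1.
by rewrite mulrn_eq0 /= => /eqP.
Qed.

End MpolyMorphisms.

(** * Degree bounds, in particular for factors of a Hessian *)

Section Degree.
Context {R : realType} {d : nat}.
Implicit Types p q : {mpoly R[d]}.

Lemma deg_leE p k : (deg p <= k)%N = (msize p <= k.+1)%N.
Proof. by rewrite /deg -subn1 leq_subLR add1n. Qed.

Lemma degC_le (c : R) k : (deg (c%:MP : {mpoly R[d]}) <= k)%N.
Proof. by rewrite deg_leE msizeC; case: (c != 0). Qed.

Lemma degXU_le i : (deg ('X_i : {mpoly R[d]}) <= 1)%N.
Proof. by rewrite deg_leE msizeX mdeg1. Qed.

Lemma degD_le p q k : (deg p <= k)%N -> (deg q <= k)%N -> (deg (p + q) <= k)%N.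
Proof.
rewrite !deg_leE => le_p le_q; apply: leq_trans (msizeD_le _ _) _.
by rewrite geq_max le_p.
Qed.

Lemma deg_sum_le (I : Type) (s : seq I) (P : pred I) (F : I -> {mpoly R[d]}) k :
  (forall i, P i -> (deg (F i) <= k)%N) -> (deg (\sum_(i <- s | P i) F i) <= k)%N.
Proof.
move=> leF; apply: (big_ind (fun p => deg p <= k)%N) => //.
- exact: (degC_le 0).
- by move=> p q; apply: degD_le.
Qed.

Lemma degM_le p q a b :
  (deg p <= a)%N -> (deg q <= b)%N -> (deg (p * q) <= a + b)%N.
Proof.
have [->|p0] := eqVneq p 0; first by rewrite mul0r => _ _; apply: (degC_le 0).
have [->|q0] := eqVneq q 0; first by rewrite mulr0 => _ _; apply: (degC_le 0).
rewrite !deg_leE msizeM // => le_p le_q.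
by rewrite -subn1 leq_subLR add1n -addnS -addSn leq_add.
Qed.

Lemma deg_mmap_affine_le (h : 'I_d -> {mpoly R[d]}) p :
  (forall i, deg (h i) <= 1)%N -> (deg (mmap (@mpolyC d R) h p) <= deg p)%N.
Proof.
move=> h1; rewrite /mmap big_seq; apply: deg_sum_le => m /msize_mdeg_lt m_lt.
rewrite -[deg p]add0n; apply: degM_le; first exact: degC_le.
apply: (@leq_trans (mdeg m)); last by rewrite -ltnS (leq_trans m_lt) // -deg_leE.
rewrite mdegE /mmap1.
apply: (big_ind2 (fun q n => deg q <= n)%N) => [||i _].
- exact: (degC_le 1).
- by move=> q1 n1 q2 n2; apply: degM_le.
elim: (m i) => [|n IH]; first exact: (degC_le 1).
by rewrite exprS -add1n; apply: degM_le.
Qed.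

(* The leading coefficient of a sum of squares is a sum of squares of leading
   coefficients, so there is no cancellation. *)
Lemma sum_sqr_mcoeff_neq0 r (s : 'I_r -> {mpoly R[d]}) l0 : s l0 != 0 ->
  exists m, (\sum_l s l ^+ 2)@_(m + m) != 0 /\
            forall l, (deg (s l) <= mdeg m)%N.
Proof.
move=> s_l0; have [l1 /= s_l1 maxP] :=
  arg_maxP (P := fun l => s l != 0) (fun l => mlead (s l)) s_l0.
have le_lead l : (mlead (s l) <= mlead (s l1))%O.
  have [->|/maxP//] := eqVneq (s l) 0.
  by rewrite mlead0 le0x.
exists (mlead (s l1)); split=> [|l].
  rewrite raddf_sum /= psumr_neq0 => [|l _].
    apply/hasP; exists l1; first exact: mem_index_enum.
    by rewrite expr2 mleadcMW //= -expr2 exprn_even_gt0 //= mleadc_eq0.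
  by rewrite expr2 mleadcMW // -expr2 sqr_ge0.
have [->|s_l] := eqVneq (s l) 0; first exact: (degC_le 0).
by rewrite /deg -mlead_deg //= lemc_mdeg.
Qed.

(** The k-th diagonal entry of the Hessian is the sum of squares of row k of [M], where top squares
    do not cancel; two derivatives account for the successor. *)
Lemma hessian_factor_deg p r (M : 'M[{mpoly R[d]}]_(d, r)) k l :
  hessian p = M *m M^T -> M k l != 0 -> (2 * (deg (M k l)).+1 <= deg p)%N.
Proof.
move=> hessE /(sum_sqr_mcoeff_neq0 (s := M k))[m [+ le_m]].
have -> : \sum_l M k l ^+ 2 = p^`M(k)^`M(k).
  have /matrixP/(_ k k) := hessE; rewrite !mxE => ->.
  by apply: eq_bigr => i _; rewrite mxE expr2.
rewrite !mcoeff_deriv !mulrn_eq0 /= -mcoeff_msupp => /msize_mdeg_lt.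
rewrite !mdegD !mdeg1 /deg; have := le_m l; rewrite /deg.
by move: (msize p) => [|N] //=; lia.
Qed.

End Degree.

(** Turns the pointwise Hessian identities of the definitions into formal ones, to which
    substitutions and linear forms apply. *)
Lemma mxeval_inj (R : realType) d p q (A B : 'M[{mpoly R[d]}]_(p, q)) :
  (forall x, mxeval x A = mxeval x B) -> A = B.
Proof.
move=> eqAB; apply/matrixP => i j; apply/eqP; rewrite -subr_eq0; apply/eqP.
apply: mpoly_eq0_meval => x; have /matrixP/(_ i j) := eqAB x.
by rewrite !mxE mevalB => ->; rewrite subrr.
Qed.

(** * The segment from [y] to x, and its image under a linear form *)

Section Segment.
Context {R : realType} {d : nat}.
Implicit Types (p : {mpoly R[d]}) (y : 'I_d -> R).

Definition seg_dir y (i : 'I_d) : {mpoly R[d]} := 'X_i - (y i)%:MP.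

(* The polynomial [x |-> p (y + t (x - y))]. *)
Definition seg y (t : R) : {mpoly R[d]} -> {mpoly R[d]} :=
  mmap (@mpolyC d R) (fun i => (y i)%:MP + seg_dir y i * t%:MP).

HB.instance Definition _ y t := GRing.RMorphism.on (seg y t).

Lemma seg0 y p : seg y 0 p = p.@[y]%:MP.
Proof.
rewrite /seg /meval /mmap rmorph_sum; apply: eq_bigr => m _ /=.
rewrite rmorphM /=; congr (_ * _); rewrite /mmap1 rmorph_prod.
by apply: eq_bigr => i _; rewrite rmorphXn /= mulr0 addr0.
Qed.

Lemma seg1 y p : seg y 1 p = p.
Proof.
rewrite [RHS]mpolyE /seg /mmap; apply: eq_bigr => m _.
rewrite mul_mpolyC mpolyXE_id; congr (_ *: _); apply: eq_bigr => i _.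
by rewrite mulr1 addrC subrK.
Qed.

Lemma deg_seg_dir y i : (deg (seg_dir y i) <= 1)%N.
Proof.
by rewrite /seg_dir -mpolyCN; apply: degD_le; [apply: degXU_le|apply: degC_le].
Qed.

Lemma deg_seg y t p : (deg (seg y t p) <= deg p)%N.
Proof.
apply: deg_mmap_affine_le => i; apply: degD_le; first exact: degC_le.
by rewrite -[1%N]addn0; apply: degM_le; [apply: deg_seg_dir|apply: degC_le].
Qed.

(** This is [u^T M M^T u = |M^T u|^2] for the direction [u = x - y]. *)
Lemma seg_gram y t r (M : 'M[{mpoly R[d]}]_(d, r)) :
  \sum_i \sum_k seg y t ((M *m M^T) i k) * (seg_dir y i * seg_dir y k) =
  \sum_l (\sum_i seg y t (M i l) * seg_dir y i) ^+ 2.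
Proof.
under [RHS]eq_bigr do rewrite expr2 big_distrlr /=.
rewrite [RHS]exchange_big /=; apply: eq_bigr => i _.
rewrite exchange_big /=; apply: eq_bigr => k _.
rewrite mxE rmorph_sum mulr_suml; apply: eq_bigr => l _.
by rewrite mxE rmorphM /= mulrACA.
Qed.

Variables (psi : {scalar {mpoly R[d]}}) (y : 'I_d -> R).

(** The form [psi] acts on each coefficient in t; by linearity this commutes with evaluation at a
    real t and with differentiation in t. *)
Definition seg_poly p : {poly R} :=
  map_poly psi (mpoly_line (@mpolyC d R) (fun i => (y i)%:MP) (seg_dir y) p).

Lemma seg_polyN p : seg_poly (- p) = - seg_poly p.
Proof. by rewrite /seg_poly !raddfN. Qed.

Lemma horner_map_scalar (P : {poly {mpoly R[d]}}) t :
  (map_poly psi P).[t] = psi P.[t%:MP].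
Proof.
rewrite (@horner_coef_wide _ (size P)) ?size_poly // horner_coef raddf_sum.
apply: eq_bigr => i _; rewrite coef_map /= -rmorphXn /= mulrC.
by rewrite [P`_i * _]mulrC mul_mpolyC linearZ.
Qed.

Lemma deriv_map_scalar (P : {poly {mpoly R[d]}}) :
  (map_poly psi P)^`() = map_poly psi P^`().
Proof. by apply/polyP => i; rewrite !(coef_map, coef_deriv) //= raddfMn. Qed.

Lemma horner_seg_poly p t : (seg_poly p).[t] = psi (seg y t p).
Proof. by rewrite horner_map_scalar horner_mpoly_line. Qed.

Lemma deriv_seg_poly p t :
  (seg_poly p)^`().[t] = psi (\sum_i seg y t p^`M(i) * seg_dir y i).
Proof.
rewrite deriv_map_scalar horner_map_scalar deriv_mpoly_line horner_sum.
congr (psi _); apply: eq_bigr => i _.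
by rewrite hornerM hornerC horner_mpoly_line.
Qed.

Lemma deriv2_seg_poly p t :
  (seg_poly p)^`()^`().[t] =
  psi (\sum_i \sum_k seg y t (hessian p i k) * (seg_dir y i * seg_dir y k)).
Proof.
rewrite !deriv_map_scalar horner_map_scalar deriv_mpoly_line raddf_sum horner_sum.
congr (psi _); apply: eq_bigr => i _.
rewrite /= derivM derivC mulr0 addr0 deriv_mpoly_line hornerM hornerC horner_sum.
rewrite mulr_suml; apply: eq_bigr => k _.
by rewrite hornerM hornerC horner_mpoly_line mxE -mulrA [seg_dir y k * _]mulrC.
Qed.

End Segment.

(** * The Riesz functional and localizing matrices *)

Section Riesz.
Context {R : realType} {d n : nat}.
Variable phi : 'X_{1..d < (2 * n).+1} -> R.

Fact riesz_is_scalar : scalar (riesz phi).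
Proof.
move=> c p q; rewrite /riesz mulr_sumr -big_split; apply: eq_bigr => a _ /=.
by rewrite mcoeffD mcoeffZ mulrDl mulrA.
Qed.

HB.instance Definition _ :=
  GRing.isLinear.Build R {mpoly R[d]} R _ (riesz phi) riesz_is_scalar.

(** The right-hand quantity is the quadratic form of the localizing matrix at the coefficient vector
    of [q], which is indexed by exponents of degree at most [k]. *)
Lemma riesz_sqr_ge0 k (g q : {mpoly R[d]}) :
  psdmx (localizing_mx k g phi) -> (deg q <= k)%N -> 0 <= riesz phi (q ^+ 2 * g).
Proof.
move=> [_ psd]; rewrite deg_leE => /mpolywE qE.
have := psd (\col_i q@_(enum_val i : 'X_{1..d < k.+1})).
congr (0 <= _); rewrite -mulmxA mxE.
rewrite {3}qE expr2 big_distrlr /= mulr_suml raddf_sum.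
rewrite [RHS](big_enum_val (A := {: 'X_{1..d < k.+1}})) /=.
apply: eq_bigr => i _; rewrite !mxE mulr_sumr mulr_suml raddf_sum.
rewrite [RHS](big_enum_val (A := {: 'X_{1..d < k.+1}})) /=.
apply: eq_bigr => j _; rewrite !mxE.
rewrite -!scalerAl -!scalerAr -scalerAl !linearZ /= -mpolyXD.
by congr (_ * _); rewrite mulrC.
Qed.

End Riesz.

(** * Concavity along the segment from SOS-concavity *)

Section SegmentPositivity.
Context {R : realType} {d : nat}.
Implicit Types (psi : {scalar {mpoly R[d]}}) (g : {mpoly R[d]}).

(** The second derivative is minus [psi] of a sum of squares. A nonzero entry of [M] has degree at
    most [deg g / 2 - 1], and the direction adds 1, so each root stays within [half_deg g]. *)
Lemma SOS_concave_seg_poly psi y g : SOS_concave g ->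
  (forall s, (deg s <= half_deg g)%N -> 0 <= psi (s ^+ 2)) ->
  forall t, (seg_poly psi y g)^`()^`().[t] <= 0.
Proof.
move=> [r [M hessM]] psi_ge0 t.
have hessE : hessian (- g) = M *m M^T.
  by apply: mxeval_inj => x; rewrite hessM /mxeval map_mxM map_trmx.
have -> : seg_poly psi y g = - seg_poly psi y (- g).
  by rewrite seg_polyN opprK.
rewrite !derivN hornerN oppr_le0 deriv2_seg_poly hessE seg_gram raddf_sum.
apply: sumr_ge0 => l _; apply: psi_ge0; apply: deg_sum_le => i _.
have [->|M_neq0] := eqVneq (M i l) 0.
  by rewrite raddf0 mul0r; apply: (degC_le 0).
have := hessian_factor_deg hessE M_neq0; rewrite /half_deg /deg msizeN => le_M.
apply: (@leq_trans (deg (M i l) + 1)).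
  by apply: degM_le; [apply: deg_seg|apply: deg_seg_dir].
by move: le_M; rewrite /deg; move: (_.-1) (_.-1) => a b; lia.
Qed.

Lemma scalar_mpolyC psi c : psi c%:MP = c * psi 1.
Proof. by rewrite -[c%:MP]mulr1 mul_mpolyC linearZ. Qed.

End SegmentPositivity.

(** * Jensen inequalities at the mean, and positivity along the segment *)

Section Mean.
Context {R : realType} {d n : nat}.
Variable phi : 'X_{1..d < (2 * n).+1} -> R.
Hypothesis phi1 : riesz phi 1 = 1.
Let y (i : 'I_d) := riesz phi 'X_i.

(** At t = 0 the gradient is the constant one at [y], and each [x_i - y_i] has mean 0. *)
Lemma deriv_seg_poly_mean p : (seg_poly (riesz phi) y p)^`().[0] = 0.
Proof.
rewrite deriv_seg_poly raddf_sum big1 // => i _.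
by rewrite /= seg0 mul_mpolyC linearZ /= raddfB /= scalar_mpolyC /= phi1 mulr1 subrr mulr0.
Qed.

Lemma seg_poly_mean0 p : (seg_poly (riesz phi) y p).[0] = p.@[y].
Proof. by rewrite horner_seg_poly seg0 scalar_mpolyC /= phi1 mulr1. Qed.

Lemma riesz_convex_ge p :
  (forall t, 0 <= t <= 1 -> 0 <= (seg_poly (riesz phi) y p)^`()^`().[t]) ->
  p.@[y] <= riesz phi p.
Proof.
move=> p2_ge0; have := convex_poly_le p2_ge0 (deriv_seg_poly_mean p).
by rewrite seg_poly_mean0 horner_seg_poly seg1.
Qed.

Lemma riesz_concave_le p :
  (forall t, 0 <= t <= 1 -> (seg_poly (riesz phi) y p)^`()^`().[t] <= 0) ->
  riesz phi p <= p.@[y].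
Proof.
move=> p2_le0; rewrite -lerN2 -mevalN -raddfN; apply: riesz_convex_ge => t t01.
by rewrite seg_polyN !derivN hornerN oppr_ge0 p2_le0.
Qed.

Hypothesis phi_psd : forall q, (deg q <= n)%N -> 0 <= riesz phi (q ^+ 2).

Lemma riesz_sqr_seg_ge0 (g q : {mpoly R[d]}) :
  SOS_concave g -> psdmx (localizing_mx (n - half_deg g) g phi) ->
  (deg q + half_deg g <= n)%N ->
  forall t, 0 <= t <= 1 -> 0 <= riesz phi (q ^+ 2 * seg y t g).
Proof.
move=> g_conc g_psd le_n t t01.
have le_gn : (half_deg g <= n)%N by lia.
(* Jensen gives [g(y) >= phi(g)], and [phi(g) >= 0] is the localizing condition for the square of
   1. *)
have g_ge0 : 0 <= g.@[y].
  apply: (@le_trans _ _ (riesz phi g)).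
    rewrite -[g]mul1r -(expr1n _ 2); apply: riesz_sqr_ge0 g_psd _.
    exact: (degC_le 1).
  apply: riesz_concave_le => s _; apply: SOS_concave_seg_poly => // u le_u.
  by apply: phi_psd; apply: leq_trans le_gn.
(* The form weighted by [q^2]: it sends [s^2] to [phi((q s)^2)], and [q s] has degree at most [n]
   whenever [deg s <= half_deg g]. *)
pose psi : {scalar {mpoly R[d]}} := riesz phi \o (q ^+ 2 \*o idfun).
have psiE t' : (seg_poly psi y g).[t'] = riesz phi (q ^+ 2 * seg y t' g).
  by rewrite horner_seg_poly.
rewrite -psiE; apply: concave_poly_ge0 => //.
- move=> s _; apply: SOS_concave_seg_poly => // u le_u.
  rewrite /psi /= -exprMn; apply: phi_psd; apply: leq_trans le_n.
  exact: degM_le.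
(* The end values are [g(y) phi(q^2)] at t = 0 and [phi(q^2 g)] at t = 1. *)
- rewrite psiE seg0 mulrC mul_mpolyC linearZ /= mulr_ge0 // phi_psd //; lia.
- by rewrite psiE seg1; apply: riesz_sqr_ge0 g_psd _; lia.
Qed.

End Mean.

(** * Jensen's inequality under Hessian-Q-module convexity *)

Lemma deg_mxdeg (R : realType) d p q (L : 'M[{mpoly R[d]}]_(p, q)) k l :
  (deg (L k l) <= mxdeg L)%N.
Proof.
rewrite /mxdeg (bigD1 k) //= (bigD1 l) //=.
by rewrite -maxnA leq_maxl.
Qed.

Theorem theorem3p3 (R : realType) (d m : nat)
    (g : 'I_m.+2 -> {mpoly R[d]})
    (g_first : g ord0 = 1)
    (g_last : g ord_max = 1 - \sum_(i < d) 'X_i ^+ 2)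
    (g_concave : forall j : 'I_m.+2, j != ord0 -> SOS_concave (g j))
    (f : {mpoly R[d]})
    (r : 'I_m.+2 -> nat)
    (L : forall j : 'I_m.+2, 'M[{mpoly R[d]}]_(d, r j))
    (f_convex : Hessian_Qmodule_convex_with g L f)
    (n : nat)
    (n_large :
      (1 + maxn (\max_(j < m.+2 | j != ord0) (mxdeg (L j) + half_deg (g j)))
                (mxdeg (L ord0)) <= n)%N)
    (phi : 'X_{1..d < (2 * n).+1} -> R)
    (phi1 : riesz phi 1 = 1)
    (phi_psd : forall j : 'I_m.+2,
      psdmx (localizing_mx (n - half_deg (g j)) (g j) phi)) :
  f.@[fun i : 'I_d => riesz phi 'X_i] <= riesz phi f.
Proof.
set y := fun i => riesz phi 'X_i.
(* For j = 0 the localizing matrix is the full moment matrix, since [g ord0 = 1] has half degree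
   0. *)
have phi_sqr q : (deg q <= n)%N -> 0 <= riesz phi (q ^+ 2).
  move=> le_q; rewrite -[q ^+ 2]mulr1 -g_first.
  apply: riesz_sqr_ge0 (phi_psd ord0) _.
  by rewrite g_first /half_deg /deg msize1 subn0.
have hessE : hessian f = \sum_j g j *: (L j *m (L j)^T).
  apply: mxeval_inj => x; rewrite f_convex /mxeval raddf_sum /=.
  by apply: eq_bigr => j _; rewrite map_mxZ map_mxM map_trmx.
apply: riesz_convex_ge => // t t01; rewrite deriv2_seg_poly hessE.
have -> : \sum_i \sum_k seg y t ((\sum_j g j *: (L j *m (L j)^T)) i k)
    * (seg_dir y i * seg_dir y k) =
  \sum_j \sum_l (\sum_i seg y t (L j i l) * seg_dir y i) ^+ 2 * seg y t (g j).
  transitivity (\sum_j seg y t (g j) *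
      \sum_i \sum_k seg y t ((L j *m (L j)^T) i k) * (seg_dir y i * seg_dir y k)).
    under [RHS]eq_bigr do rewrite mulr_sumr.
    rewrite [RHS]exchange_big /=; apply: eq_bigr => i _.
    under [RHS]eq_bigr do rewrite mulr_sumr.
    rewrite [RHS]exchange_big /=; apply: eq_bigr => k _.
    rewrite summxE rmorph_sum mulr_suml; apply: eq_bigr => j _.
    by rewrite /= [X in seg y t X]mxE rmorphM -mulrA.
  apply: eq_bigr => j _; rewrite seg_gram mulr_sumr.
  by apply: eq_bigr => l _; rewrite mulrC.
rewrite raddf_sum; apply: sumr_ge0 => j _.
rewrite raddf_sum; apply: sumr_ge0 => l _.
(* The extra 1 comes from the direction [x - y]; it is the 1 in the lower bound on [n]. *)
have deg_q : (deg (\sum_i seg y t (L j i l) * seg_dir y i) <= mxdeg (L j) + 1)%N.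
  apply: deg_sum_le => i _; apply: degM_le; last exact: deg_seg_dir.
  exact: leq_trans (deg_seg _ _ _) (deg_mxdeg _ _ _).
have [j0|j_neq0] := eqVneq j ord0.
  rewrite j0 in l deg_q *; rewrite g_first rmorph1 mulr1 phi_sqr //.
  by apply: leq_trans deg_q _; lia.
apply: riesz_sqr_seg_ge0 => //; first exact: g_concave.
have : (mxdeg (L j) + half_deg (g j) < n)%N.
  move: n_large; rewrite add1n gtn_max => /andP[lt_n _].
  apply: leq_ltn_trans lt_n.
  by rewrite (bigD1 j) //= leq_maxl.
by move: deg_q; rewrite -addn1; lia.
Qed.
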